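(* Let $p\neq 2$ be a prime, and let $N_0$ be the smallest positive integer such that $T_{N_0}\equiv T_{N_0-1}\equiv 0\pmod p$. Then: (1) If $\nu_p(T_{N_0})\neq \nu_p(T_{N_0-1})$, then there is no integer $n$ such that $\nu_p(T_n)=\nu_p(T_{n-1})>0$. (2) If $\nu_p(T_{N_0})=\nu_p(T_{N_0-1})$, then when $n$ is a multiple of $N_0$ the following holds: $\nu_p(T_n)=\nu_p(T_{n-1})=\nu_p\left(\frac{n}{N_0}\right)+\nu_p(T_{N_0})$.
   Context: $(T_n)_{n\in\mathbb{Z}}$ is the Tribonacci sequence: $T_0=0$, $T_1=T_2=1$ and $T_{n+3}=T_{n+2}+T_{n+1}+T_n$ for all $n\in\mathbb{Z}$ (extended to negative indices by the recurrence, so $T_{-1}=0$). For a prime $p$ and a nonzero integer $m$, $\nu_p(m)$ is the exponent of $p$ in the factorization of $m$, and $\nu_p(0):=\infty$. The integer $N_0$ exists because $T_{-1}=T_0=0$ and the sequence is purely periodic modulo $p$.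
   Formalization: In part (1) the integer n is required to be nonzero: since T_0 = T_{-1} = 0 and ν_p(0) = ∞, n = 0 would always satisfy ν_p(T_n) = ν_p(T_{n-1}) > 0 (e.g. p = 5, N_0 = 31, where the valuations 1 and 2 differ). *)

(* Defs.v *)
From mathcomp Require Import all_boot all_order all_algebra.
From mathcomp Require Import constructive_ereal.

Set Implicit Arguments.
Unset Strict Implicit.
Unset Printing Implicit Defensive.

Import Order.TTheory GRing.Theory Num.Theory.
Local Open Scope ring_scope.

(* A state (a, b, c) stands for (T_n, T_(n+1), T_(n+2)). *)
Definition trib_next (s : int * int * int) : int * int * int :=
  let: (a, b, c) := s in (b, c, c + b + a).

Definition trib_prev (s : int * int * int) : int * int * int :=
  let: (a, b, c) := s in (c - b - a, a, b).

Definition trib_state (n : int) : int * int * int :=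
  match n with
  | Posz k => iter k trib_next (0, 1, 1)
  | Negz k => iter k.+1 trib_prev (0, 1, 1)
  end.

Definition tribonacci (n : int) : int := (trib_state n).1.1.

Lemma trib_prevK : cancel trib_prev trib_next.
Proof. by case=> [[a b] c] /=; rewrite [b + a + _]addrC -(addrA c) -opprD subrK. Qed.

Lemma trib_stateS (n : int) : trib_state (n + 1) = trib_next (trib_state n).
Proof.
case: n => [k|[|k]].
- by rewrite -PoszD addn1.
- by [].
- have -> : Negz k.+1 + 1 = Negz k by rewrite !NegzE -[k.+2]addn1 PoszD opprD addrNK.
  by rewrite /= trib_prevK.
Qed.

Lemma tribonacci0 : tribonacci 0 = 0. Proof. by []. Qed.
Lemma tribonacci1 : tribonacci 1 = 1. Proof. by []. Qed.
Lemma tribonacci2 : tribonacci 2 = 1. Proof. by []. Qed.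

Lemma tribonacci_rec (n : int) :
  tribonacci (n + 3) = tribonacci (n + 2) + tribonacci (n + 1) + tribonacci n.
Proof.
have -> : n + 3 = n + 1 + 1 + 1 by rewrite -!addrA.
have -> : n + 2 = n + 1 + 1 by rewrite -!addrA.
by rewrite /tribonacci !trib_stateS; case: (trib_state n) => [[a b] c].
Qed.

(* At index 0 both T_0 and T_(-1) vanish, so both valuations are +oo, equal and
   positive: a claim that no index has equal positive valuations must leave
   out index 0. *)
Definition nu (p : nat) (m : int) : \bar int :=
  if m == 0 then +oo%E else ((logn p `|m|%N)%:Z)%:E.

Definition consecutive_zeros_mod (p : nat) (n : int) : Prop :=
  (tribonacci n = 0 %[mod p])%Z /\ (tribonacci (n - 1) = 0 %[mod p])%Z.

Definition is_smallest_positive (P : int -> Prop) (N : int) : Prop :=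
  [/\ 0 < N, P N & forall m : int, 0 < m -> P m -> N <= m].

(* Main.v *)
Require Import Defs.
From mathcomp Require Import all_boot all_order all_algebra.
From mathcomp Require Import constructive_ereal.
From mathcomp Require Import ring zify.

Set Implicit Arguments.
Unset Strict Implicit.
Unset Printing Implicit Defensive.

Import Order.TTheory GRing.Theory Num.Theory.
Local Open Scope ring_scope.

(** In the ring R = Z[x]/(x^3 - x^2 - x - 1) the element x is a unit and
      x^n = T_(n-1) x^2 + (T_n - T_(n-1)) x + T_(n-2)   for all n in Z,
    so T_(n-1) is the x^2-coordinate of x^n and T_n is the sum of its x^2- and
    x-coordinates.  Both of these linear forms kill the constants Z, and a
    prime p divides T_n and T_(n-1) exactly when x^n is an integer modulo pR.
    The indices n with this property form a subgroup of Z, generated by N0.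

    Let p^e be the exact power of p in gcd(T_N0, T_(N0-1)); the gcd is nonzero
    since T_n > 0 for n > 0.  Then x^N0 = c + p^e W with p not dividing c, and
    at least one of the two linear forms is a p-unit at W.  Raising to the
    power k is governed, p being odd and e > 0, by the first-order term
      x^(k N0) = d + p^(e + nu_p(k)) (u W + p Z),   p dividing neither d nor u
    (lemma trib_power_first_order), as in the usual lifting-the-exponent
    argument; the hypothesis that p is odd enters through p | C(p, 2).

    Hence, for every k <> 0, the valuation of T_(k N0) equals e + nu_p(k) if
    and only if the form of T_n is a unit at W, and likewise for T_(k N0 - 1)
    (lemma nu_first_order).  The two criteria do not depend on k.  If T_(k N0)
    and T_(k N0 - 1) have equal valuations for one k <> 0 then, since one of
    the two forms is a unit at W, both are, and then the two valuations equal
    e + nu_p(k) for all k <> 0.  Both assertions follow, the first because any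
    n with nu_p(T_n) = nu_p(T_(n-1)) > 0 is a multiple of N0. *)

(** * Divisibility and valuation of integers *)

Lemma prime_dvdzM (p : nat) (a b : int) : prime p ->
  (p %| a * b)%Z = (p %| a)%Z || (p %| b)%Z.
Proof. by move=> p_pr; rewrite !dvdzE abszM Euclid_dvdM. Qed.

Lemma prime_dvdzX (p : nat) (a : int) (k : nat) : prime p ->
  (p %| a ^+ k)%Z -> (p %| a)%Z.
Proof. by move=> p_pr; rewrite !dvdzE abszX Euclid_dvdX // => /andP[]. Qed.

Lemma nu_pfactorM (p F : nat) (a : int) : prime p -> ~~ (p %| a)%Z ->
  nu p ((p ^ F)%N%:Z * a) = (F%:Z)%:E.
Proof.
move=> p_pr pa; rewrite /nu mulf_eq0.
have p_gt0 := prime_gt0 p_pr.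
have a_neq0 : a != 0 by apply: contraNneq pa => ->; rewrite dvdz0.
have /negPf -> : (p ^ F)%N%:Z != 0 :> int.
  by rewrite eqz_nat -lt0n expn_gt0 p_gt0.
rewrite (negPf a_neq0) /= abszM absz_nat lognM ?expn_gt0 ?p_gt0 ?absz_gt0 //.
rewrite pfactorK // logn_coprime ?addn0 //.
by rewrite prime_coprime // -[_ %| _]/(p%:Z %| a)%Z.
Qed.

Lemma nu_pfactorM_neq (p F : nat) (a : int) : prime p -> (p %| a)%Z ->
  nu p ((p ^ F)%N%:Z * a) <> (F%:Z)%:E.
Proof.
move=> p_pr pa; rewrite /nu mulf_eq0.
have p_gt0 := prime_gt0 p_pr.
have /negPf -> : (p ^ F)%N%:Z != 0 :> int.
  by rewrite eqz_nat -lt0n expn_gt0 p_gt0.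
case: eqVneq => //= a_neq0.
rewrite abszM absz_nat lognM ?expn_gt0 ?p_gt0 ?absz_gt0 // pfactorK //.
case=> /eqP; rewrite -[X in _ == X]addn0 eqn_add2l => /eqP v0.
have : (0 < logn p `|a|)%N by rewrite logn_gt0 mem_primes p_pr absz_gt0 a_neq0.
by rewrite v0.
Qed.

Lemma dvdz_of_nu_gt0 (p : nat) (a : int) : (0 < nu p a)%E -> (p %| a)%Z.
Proof.
rewrite /nu; case: eqVneq => [->|a_neq0]; first by rewrite dvdz0.
rewrite lte_fin ltz_nat logn_gt0 mem_primes => /and3P[_ _].
by rewrite dvdzE.
Qed.

(** * First-order expansions modulo powers of p *)

Section FirstOrder.

Variables (R : comNzRingType) (p : nat).

(** The direction W is fixed once and for all: powers and inverses change the
    unit coefficients d and u and the precision F, but not W, which is why one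
    test on W decides all valuations at once. *)
Definition first_order (F : nat) (W g : R) :=
  exists d u : int, exists Z : R,
    [/\ ~~ (p %| d)%Z, ~~ (p %| u)%Z
      & g = d%:~R + p%:R ^+ F * (u%:~R * W + p%:R * Z)].

(** For k < 2 the truncated exponents k.-1 and k.-2 are harmless, as the
    coefficients in front of them vanish or the exponents are right.  The term
    in b^2 is kept exact because, at k = p and with b divisible by p only once,
    it needs the factor p of its binomial coefficient to be negligible. *)
Lemma exprD_second_order (a b : R) (k : nat) : exists z : R,
  (a + b) ^+ k = a ^+ k + k%:R * a ^+ k.-1 * b
                 + ('C(k, 2))%:R * a ^+ k.-2 * b ^+ 2 + b ^+ 3 * z.
Proof.
elim: k => [|k [z IH]]; first by exists 0; rewrite bin_small //=; ring.
case: k IH => [|[|k]] IH.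
- by exists 0; rewrite bin_small //=; ring.
- by exists 0; rewrite binn /=; ring.
exists (('C(k.+2, 2))%:R * a ^+ k + (a + b) * z).
rewrite exprS IH (binS k.+2 1) bin1 /= natrD -(natr1 k.+2) !exprS; ring.
Qed.

Hypotheses (p_pr : prime p) (p_odd : odd p).

(** A p-th power gains exactly one factor p: the linear term has coefficient p,
    the quadratic one is divisible by p^(2F+1) because p is odd, and the rest
    by p^(3F); both exponents are at least F + 2. *)
Lemma first_order_exp_p (F : nat) (W g : R) : (0 < F)%N ->
  first_order F W g -> first_order F.+1 W (g ^+ p).
Proof.
case: F => // f _ [d [u [Z [pd pu ->]]]].
have [z ->] := exprD_second_order d%:~R
  (p%:R ^+ f.+1 * (u%:~R * W + p%:R * Z)) p.
rewrite bin2odd //.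
set V := u%:~R * W + p%:R * Z.
exists (d ^+ p), (d ^+ p.-1 * u).
exists (d%:~R ^+ p.-1 * Z + (p.-1./2)%:R * d%:~R ^+ p.-2 * p%:R ^+ f * V ^+ 2
        + p%:R ^+ f * p%:R ^+ f * V ^+ 3 * z).
split; first by apply: contraNN pd; apply: prime_dvdzX.
  rewrite prime_dvdzM // negb_or pu andbT.
  by apply: contraNN pd; apply: prime_dvdzX.
rewrite natrM !intrM !rmorphXn /= !exprS -/V.
move: (p%:R ^+ f) (d%:~R ^+ p.-1) (d%:~R ^+ p.-2) => P D1 D2.
rewrite /V; ring.
Qed.

Lemma first_order_exp_coprime (F k : nat) (W g : R) :
  (0 < F)%N -> ~~ (p %| k)%N ->
  first_order F W g -> first_order F W (g ^+ k).
Proof.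
case: F => // f _ pk [d [u [Z [pd pu ->]]]].
set V := u%:~R * W + p%:R * Z.
have [z ->] := exprD_second_order d%:~R (p%:R ^+ f.+1 * V) k.
exists (d ^+ k), (k%:Z * d ^+ k.-1 * u).
exists (k%:R * d%:~R ^+ k.-1 * Z
        + ('C(k, 2))%:R * d%:~R ^+ k.-2 * p%:R ^+ f * V ^+ 2
        + p%:R ^+ f * p%:R ^+ f * p%:R * V ^+ 3 * z).
split; first by apply: contraNN pd; apply: prime_dvdzX.
  rewrite !prime_dvdzM // !negb_or pu andbT pk.
  by apply: contraNN pd; apply: prime_dvdzX.
rewrite !intrM !rmorphXn /= !exprS.
move: (p%:R ^+ f) (d%:~R ^+ k.-1) (d%:~R ^+ k.-2) => P D1 D2.
rewrite /V; ring.
Qed.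

(** Write k = p^v m with m prime to p, and take v p-th powers before the m-th. *)
Lemma first_order_exp (F k : nat) (W g : R) : (0 < F)%N -> (0 < k)%N ->
  first_order F W g -> first_order (F + logn p k) W (g ^+ k).
Proof.
move=> F_gt0 k_gt0 gW.
have [m pm km] := pfactor_coprime p_pr k_gt0.
rewrite [in X in g ^+ X]km mulnC exprM.
apply: first_order_exp_coprime; first by rewrite addn_gt0 F_gt0.
  by rewrite -prime_coprime.
elim: (logn p k) => [|v IH]; first by rewrite addn0 expn0 expr1.
rewrite addnS expnSr exprM; apply: first_order_exp_p => //.
by rewrite addn_gt0 F_gt0.
Qed.

(** If s is an inverse of d modulo p^(F+1), the inverse of d + p^F V is
    s - s^2 p^F V modulo p^(F+1). *)
Lemma first_order_inv (F : nat) (W g h : R) : (0 < F)%N -> g * h = 1 ->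
  first_order F W g -> first_order F W h.
Proof.
case: F => // f _ gh1 [d [u [Z [pd pu gE]]]].
set V := u%:~R * W + p%:R * Z in gE.
have : coprimez d (p%:Z ^+ f.+2).
  rewrite coprimez_sym coprimezE abszX absz_nat coprimeXl //.
  by rewrite prime_coprime.
case/coprimezP=> -[s t] /= st1.
have ps : ~~ (p %| s)%Z.
  apply/negP => ps; have : (p %| 1%R)%Z.
    by rewrite -st1 exprS rpredD ?(dvdz_mulr _ ps) // dvdz_mull // dvdz_mulr.
  by rewrite dvdzE dvdn1; case: (p) p_pr => [|[]].
have st1R : s%:~R * d%:~R + t%:~R * p%:R ^+ f.+2 = 1 :> R.
  apply: etrans (congr1 (fun a : int => a%:~R : R) st1).
  by rewrite /= intrD (intrM _ s) (intrM _ t) rmorphXn.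
have hE : h = s%:~R - s%:~R * p%:R ^+ f.+1 * V * h + t%:~R * p%:R ^+ f.+2 * h.
  have hs : s%:~R = s%:~R * ((d%:~R + p%:R ^+ f.+1 * V) * h) :> R.
    by rewrite -gE gh1 mulr1.
  rewrite [X in X - _]hs.
  transitivity ((s%:~R * d%:~R + t%:~R * p%:R ^+ f.+2) * h); last by ring.
  by rewrite st1R mul1r.
exists s, (- s ^+ 2 * u).
exists (- s%:~R ^+ 2 * Z + s%:~R ^+ 2 * p%:R ^+ f * V ^+ 2 * h
        - s%:~R * p%:R ^+ f * V * t%:~R * p%:R * h + t%:~R * h).
split=> //.
  rewrite prime_dvdzM // negb_or pu andbT dvdzE abszN -dvdzE.
  by apply: contraNN ps; apply: prime_dvdzX.
(* Substituting the expansion of h once into itself isolates the linear term. *)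
rewrite {1}hE {1}hE intrM rmorphN rmorphXn /= !exprS.
move: (p%:R ^+ f) => P; rewrite /V; ring.
Qed.

(** Since psi kills the integers, psi g = p^F (u psi(W) + p psi(Z)). *)
Lemma nu_first_order (psi : {additive R -> int}) (F : nat) (W g : R) :
  psi 1 = 0 -> first_order F W g ->
  nu p (psi g) = (F%:Z)%:E <-> ~~ (p %| psi W)%Z.
Proof.
move=> psi1 [d [u [Z [_ pu ->]]]].
have -> : psi (d%:~R + p%:R ^+ F * (u%:~R * W + p%:R * Z))
        = (p ^ F)%N%:Z * (u * psi W + p%:Z * psi Z).
  rewrite -natrX mulr_natl mulrzl mulr_natl raddfD raddfMz psi1 mul0rz add0r.
  rewrite raddfMn [psi (_ + _)]raddfD [psi (_ *~ u)]raddfMz.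
  rewrite [psi (_ *+ p)]raddfMn.
  by rewrite -mulr_natl -[psi Z *+ p]mulr_natl mulrzz !natz [psi W * u]mulrC.
have pE : (p %| u * psi W + p%:Z * psi Z)%Z = (p %| psi W)%Z.
  rewrite rpredDr; last exact: dvdz_mulr.
  by rewrite prime_dvdzM // (negPf pu).
rewrite -pE; split; last exact: nu_pfactorM.
by move=> nuF; apply/negP => pW; apply: nu_pfactorM_neq nuF.
Qed.

End FirstOrder.

(** * Tribonacci numbers as coordinates of powers of a root *)

Section TribonacciRing.

Variables (R : comNzRingType) (x : R).
Hypothesis x_root : x ^+ 3 = x ^+ 2 + x + 1.

(** This is x^n, for positive and negative n alike, written so that no inverse
    of x is needed. *)
Definition trib_power (n : int) : R :=
  (tribonacci (n - 1))%:~R * x ^+ 2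
  + (tribonacci n - tribonacci (n - 1))%:~R * x + (tribonacci (n - 2))%:~R.

Lemma trib_power0 : trib_power 0 = 1.
Proof.
have [T1 T2] : tribonacci (0 - 1) = 0 /\ tribonacci (0 - 2) = 1 by [].
by rewrite /trib_power T1 T2 tribonacci0 subr0 !mul0r !add0r.
Qed.

Lemma trib_powerS (n : int) : trib_power (n + 1) = x * trib_power n.
Proof.
have recn := tribonacci_rec (n - 2); rewrite /trib_power.
rewrite addrK (_ : n + 1 - 2 = n - 1); last by ring.
have -> : tribonacci (n + 1)
        = tribonacci n + tribonacci (n - 1) + tribonacci (n - 2).
  rewrite -(_ : n - 2 + 3 = n + 1) ?recn; last by ring.
  by congr (tribonacci _ + tribonacci _ + _); ring.
have x3 : x * x ^+ 2 = x ^+ 2 + x + 1 by rewrite -exprS.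
rewrite !mulrDr [x * (_ * x ^+ 2)]mulrCA x3; ring.
Qed.

Lemma trib_power_mul (m n : int) :
  trib_power (m + n) = trib_power m * trib_power n.
Proof.
have xI : injective ( *%R x).
  (* x (x^2 - x - 1) = 1. *)
  apply: (can_inj (g := *%R (x ^+ 2 - x - 1))) => y.
  rewrite mulrA -[RHS]mul1r; congr (_ * y).
  by transitivity (x ^+ 3 - x ^+ 2 - x); [ring | rewrite x_root; ring].
elim: n => [|n IH|n IH]; first by rewrite addr0 trib_power0 mulr1.
  by rewrite -addn1 PoszD addrA !trib_powerS IH mulrCA.
apply: xI; rewrite mulrCA -!trib_powerS -addrA.
by rewrite (_ : - n.+1%:Z + 1 = - n%:Z) ?IH //; lia.
Qed.

Lemma trib_powerM_nat (n : int) (k : nat) :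
  trib_power (n * k%:Z) = trib_power n ^+ k.
Proof.
elim: k => [|k IH]; first by rewrite mulr0 trib_power0 expr0.
by rewrite -addn1 PoszD mulrDr mulr1 trib_power_mul IH addn1 exprSr.
Qed.

End TribonacciRing.

(** The quotient A[X]/(h), known only through its projection f and the
    coordinates c in the basis of powers of X: reduction modulo h does not
    change a polynomial of smaller degree. *)
Lemma quotient_ring_of_monic (A : comNzRingType) (h : {poly A}) :
  (1 < size h)%N -> h \is monic ->
  exists (R : comNzRingType) (f : {rmorphism {poly A} -> R})
    (c : nat -> {additive R -> A}),
    f h = 0 /\
    forall (q : {poly A}) (i : nat), (size q < size h)%N -> c i (f q) = q`_i.
Proof.
move=> h_gt1 h_monic.
have hE : mk_monic h = h by rewrite /mk_monic h_gt1 h_monic.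
exists {poly %/ h}, (in_qpoly h).
exists (fun i => coefp i \o @polyn _ _); split.
  by apply: val_inj; rewrite /= hE Pdiv.RingMonic.rmodpp.
by move=> q i q_lt; rewrite /= Pdiv.Ring.rmodp_small ?hE.
Qed.

(** Here cst is the constant coordinate, prv the x^2-coordinate, and cur the sum
    of the x- and x^2-coordinates. *)
Lemma tribonacci_ring : exists (R : comNzRingType) (x : R)
    (cst cur prv : {additive R -> int}),
  x ^+ 3 = x ^+ 2 + x + 1 /\
  [/\ cst 1 = 1, cur 1 = 0, prv 1 = 0 &
   forall n, cur (trib_power x n) = tribonacci n /\
             prv (trib_power x n) = tribonacci (n - 1)].
Proof.
pose h : {poly int} := 'X^3 - ('X^2 + 'X + 1).
have sz : (size ('X^2 + 'X + 1 : {poly int})%R < 4)%N.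
  rewrite ltnS (leq_trans (size_polyD _ _)) // geq_max size_poly1 andbT.
  by rewrite (leq_trans (size_polyD _ _)) // size_polyXn size_polyX.
have szh : size h = 4%N by rewrite size_polyDl ?size_polyN ?size_polyXn.
have h_monic : h \is monic.
  by rewrite monicE lead_coefDl ?size_polyN ?size_polyXn // lead_coefXn.
have [||R [f [c [fh cE]]]] := @quotient_ring_of_monic _ h; rewrite ?szh //.
rewrite szh in cE.
exists R, (f 'X), (c 0%N), (c 1%N \+ c 2%N), (c 2%N); split.
  apply/eqP; rewrite -subr_eq0 -(rmorph1 f) -!rmorphXn -!rmorphD -rmorphB.
  by rewrite -/h fh.
have c1 i : c i 1 = (1 : {poly int})`_i by rewrite -(rmorph1 f) cE ?size_poly1.
split=> [|||n]; rewrite ?c1 /= ?c1 ?coef1 //.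
pose q : {poly int} := tribonacci (n - 1) *: 'X^2
  + (tribonacci n - tribonacci (n - 1)) *: 'X + (tribonacci (n - 2))%:P.
have -> : trib_power (f 'X) n = f q.
  rewrite /q -!mul_polyC /trib_power.
  move: (tribonacci n - _) => b.
  rewrite !rmorphD [f (_ * 'X^2)]rmorphM rmorphXn [f (_ * 'X)]rmorphM.
  have fC a : f a%:P = a%:~R by rewrite -[a in LHS]intz !rmorph_int.
  by rewrite !fC.
have q_lt : (size q < 4)%N.
  rewrite /q (leq_ltn_trans (size_polyD _ _)) // gtn_max.
  rewrite (leq_ltn_trans (size_polyD _ _)) ?gtn_max.
    by rewrite (leq_ltn_trans (size_polyC_leq1 _)).
  by rewrite !(leq_ltn_trans (size_scale_leq _ _)) ?size_polyXn ?size_polyX.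
rewrite /=.
by rewrite !(cE _ _ q_lt) /q !coefE /=; split; ring.
Qed.


(** * Indices of consecutive zeros modulo p *)

Lemma tribonacci_gt0 (k : nat) : 0 < tribonacci k.+1.
Proof.
suff : let: (a, b, c) := trib_state k.+1 in [/\ 0 < a, 0 < b & 0 < c].
  by rewrite /tribonacci; case: (trib_state _) => [[a b] c] [].
elim: k => // k; rewrite -[k.+2]addn1 PoszD trib_stateS.
by case: (trib_state _) => [[a b] c] /= [a0 b0 c0]; rewrite !addr_gt0.
Qed.

Lemma consecutive_zeros_modP (p : nat) (n : int) :
  consecutive_zeros_mod p n <->
  (p %| tribonacci n)%Z /\ (p %| tribonacci (n - 1))%Z.
Proof.
rewrite /consecutive_zeros_mod !mod0z.
by split=> -[/dvdz_mod0P ? /dvdz_mod0P ?].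
Qed.

(** Otherwise the remainder of n modulo N would be a smaller positive element. *)
Lemma smallest_positive_dvdz (P : int -> Prop) (N n : int) :
  is_smallest_positive P N -> (forall a b, P a -> P b -> P (a + b)) ->
  (forall k, P (N * k)) -> P n -> (N %| n)%Z.
Proof.
case=> N_gt0 _ N_least PD PM Pn; apply/dvdz_mod0P/eqP.
apply: contraTT isT => r_neq0.
have r_gt0 : 0 < (n %% N)%Z by rewrite lt_def r_neq0 modz_ge0 ?lt0r_neq0.
have rE : (n %% N)%Z = n + N * - (n %/ N)%Z.
  by rewrite {2}(divz_eq n N); ring.
suff : N <= (n %% N)%Z by rewrite leNgt ltz_pmod.
by apply: N_least => //; rewrite rE; apply: PD.
Qed.

(** The ring enters only through the properties given by tribonacci_ring. *)
Section Multiples.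

Variables (R : comNzRingType) (x : R) (cst cur prv : {additive R -> int}).
Hypotheses (x_root : x ^+ 3 = x ^+ 2 + x + 1).
Hypotheses (cst_1 : cst 1 = 1) (cur_1 : cur 1 = 0) (prv_1 : prv 1 = 0).
Hypothesis curE : forall n, cur (trib_power x n) = tribonacci n.
Hypothesis prvE : forall n, prv (trib_power x n) = tribonacci (n - 1).
Variables (p : nat) (p_pr : prime p) (p_odd : odd p).

(** W is x^N with its constant term removed, divided by m. *)
Lemma trib_power_split (N m : int) :
  (m %| tribonacci N)%Z -> (m %| tribonacci (N - 1))%Z ->
  exists W : R,
    [/\ trib_power x N = (tribonacci (N - 2))%:~R + m%:~R * W,
        tribonacci N = m * cur W & tribonacci (N - 1) = m * prv W].
Proof.
move=> /dvdzP[b TN] /dvdzP[a TN1].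
have gE : trib_power x N = (tribonacci (N - 2))%:~R
          + m%:~R * (a%:~R * x ^+ 2 + (b - a)%:~R * x).
  by rewrite /trib_power TN TN1 !rmorphB !rmorphM /=; ring.
exists (a%:~R * x ^+ 2 + (b - a)%:~R * x); split=> //.
  rewrite -curE gE mulrzl raddfD !raddfMz cur_1 mul0rz add0r.
  by rewrite mulrzz mulrC.
rewrite -prvE gE mulrzl raddfD !raddfMz prv_1 mul0rz add0r.
by rewrite mulrzz mulrC.
Qed.

Lemma dvdz_coord (psi : {additive R -> int}) (d m : int) (Z : R) :
  psi 1 = 0 -> (m %| psi (d%:~R + m%:~R * Z)%R)%Z.
Proof.
move=> psi1; rewrite mulrzl raddfD !raddfMz psi1 mul0rz add0r.
by rewrite mulrzz dvdz_mull.
Qed.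

(** A product of two elements that are integers modulo p is again one. *)
Lemma consecutive_zeros_mod_add (m n : int) :
  consecutive_zeros_mod p m -> consecutive_zeros_mod p n ->
  consecutive_zeros_mod p (m + n).
Proof.
move=> /consecutive_zeros_modP[m0 m1] /consecutive_zeros_modP[n0 n1].
have [V [gm _ _]] := trib_power_split m0 m1.
have [W [gn _ _]] := trib_power_split n0 n1.
set d := tribonacci (m - 2) in gm; set d' := tribonacci (n - 2) in gn.
have gmn : trib_power x (m + n) = (d * d')%:~R
    + p%:~R * (d%:~R * W + d'%:~R * V + p%:~R * V * W).
  by rewrite (trib_power_mul x_root) gm gn intrM; ring.
apply/consecutive_zeros_modP; rewrite -curE -prvE gmn.
by split; apply: dvdz_coord.
Qed.

(** Taking e from the gcd of T_N and T_(N-1) makes W indivisible: if p divided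
    both coordinates of W, then p^(e+1) would divide the gcd. *)
Lemma trib_power_first_order (N : int) :
  tribonacci N != 0 -> consecutive_zeros_mod p N ->
  exists (e : nat) (W : R),
    [/\ (0 < e)%N, ~~ ((p %| cur W)%Z && (p %| prv W)%Z)
      & forall k : int, k != 0 ->
        first_order p (e + logn p `|k|) W (trib_power x (N * k))].
Proof.
move=> TN0 /consecutive_zeros_modP [pT pT1].
set g := gcdz (tribonacci N) (tribonacci (N - 1)).
have g_neq0 : g != 0 by rewrite gcdz_eq0 (negPf TN0).
have g_gt0 : (0 < `|g|)%N by rewrite absz_gt0.
set e := logn p `|g|.
have dvd_g k : (((p ^ k)%N : int) %| g)%Z = (k <= e)%N.
  by rewrite dvdzE pfactor_dvdn.
have e_gt0 : (0 < e)%N by rewrite -dvd_g expn1 dvdz_gcd pT.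
have : (((p ^ e)%N : int) %| g)%Z by rewrite dvd_g.
rewrite dvdz_gcd => /andP[eT eT1].
have [W [gE curW prvW]] := trib_power_split eT eT1.
exists e, W; split=> //.
  apply/negP=> /andP[pc1 pc2]; have := dvd_g e.+1.
  by rewrite ltnn dvdz_gcd curW prvW expnSr PoszM !dvdz_mul.
have g1 : first_order p e W (trib_power x N).
  exists (tribonacci (N - 2)), 1, 0; split.
  - (* If p divided the constant term too, it would divide the unit x^N. *)
    apply/negP => pT2.
    have : (trib_power x N * trib_power x (- N)) = 1.
      by rewrite -(trib_power_mul x_root) subrr trib_power0.
    have /dvdzP[d dE] := pT2; rewrite gE dE.
    have /dvdzP[q ->] : ((p : int) %| (p ^ e)%N%:Z)%Z.
      by rewrite dvdzE /= dvdn_exp.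
    move=> /(congr1 cst); rewrite cst_1 => c0p.
    have : (p %| 1%R)%Z.
      rewrite -c0p -[X in cst X](_ : p%:~R * ((d%:~R + q%:~R * W)
        * trib_power x (- N)) = _); last by rewrite !intrM; ring.
      by rewrite mulrzl raddfMz mulrzz dvdz_mull.
    by rewrite dvdzE dvdn1; case: (p) p_pr => [|[]].
  - by rewrite dvdzE dvdn1; case: (p) p_pr => [|[]].
  - by rewrite mul1r mulr0 addr0 gE -natrX.
have pos k : first_order p (e + logn p k.+1) W (trib_power x (N * k.+1)).
  by rewrite trib_powerM_nat //; apply: first_order_exp.
case=> [[|k]|k] // _; first exact: pos.
apply: (first_order_inv p_pr _ _ (pos k)); first by rewrite addn_gt0 e_gt0.
by rewrite -trib_power_mul // NegzE mulrN subrr trib_power0.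
Qed.

Lemma consecutive_zeros_mod_first_order (F : nat) (W : R) (n : int) :
  (0 < F)%N -> first_order p F W (trib_power x n) -> consecutive_zeros_mod p n.
Proof.
move=> F_gt0 [d [u [Z [_ _ gE]]]].
have /dvdzP[q qE] : ((p : int) %| (p ^ F)%N%:Z)%Z.
  by rewrite dvdzE /= dvdn_exp.
apply/consecutive_zeros_modP; rewrite -curE -prvE gE.
rewrite -natrX -[(_ ^ _)%:R]/((_ ^ _)%N%:Z%:~R) qE.
by rewrite [q * _]mulrC intrM -mulrA; split; apply: dvdz_coord.
Qed.

End Multiples.

Theorem theorem1 (p : nat) (p_prime : prime p) (p_neq2 : p <> 2%N)
    (N0 : int) (N0_min : is_smallest_positive (consecutive_zeros_mod p) N0) :
  (nu p (tribonacci N0) <> nu p (tribonacci (N0 - 1)) ->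
    ~ exists n : int,
        [/\ n <> 0,
            nu p (tribonacci n) = nu p (tribonacci (n - 1))
          & (0 < nu p (tribonacci (n - 1)))%E]) /\
  (nu p (tribonacci N0) = nu p (tribonacci (N0 - 1)) ->
    forall n : int, (N0 %| n)%Z ->
      nu p (tribonacci n) = nu p (tribonacci (n - 1)) /\
      nu p (tribonacci (n - 1)) =
        (nu p (n %/ N0)%Z + nu p (tribonacci N0))%E).
Proof.
have p_odd : odd p by case: (even_prime p_prime).
case: N0_min => N0_gt0 N0_zero N0_least.
have TN0 : tribonacci N0 != 0.
  case: N0 N0_gt0 {N0_zero N0_least} => [[|k]|k] // _.
  by rewrite gt_eqF ?tribonacci_gt0.
have [R [x [cst [cur [prv [x_root [cst_1 cur_1 prv_1 cE]]]]]]] :=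
  tribonacci_ring.
have curE n := (cE n).1; have prvE n := (cE n).2.
have [e [W [e_gt0 pW foW]]] := trib_power_first_order
  x_root cst_1 cur_1 prv_1 curE prvE p_prime p_odd TN0 N0_zero.
have nu1 k : k != 0 ->
    nu p (tribonacci (N0 * k)) = ((e + logn p `|k|)%N%:Z)%:E <->
    ~~ (p %| cur W)%Z.
  by move=> k0; rewrite -curE; apply: nu_first_order (foW _ k0).
have nu2 k : k != 0 ->
    nu p (tribonacci (N0 * k - 1)) = ((e + logn p `|k|)%N%:Z)%:E <->
    ~~ (p %| prv W)%Z.
  by move=> k0; rewrite -prvE; apply: nu_first_order (foW _ k0).
(* One coordinate of W is a unit, so equal valuations make the other one too. *)
have both_units k : k != 0 ->
    nu p (tribonacci (N0 * k)) = nu p (tribonacci (N0 * k - 1)) ->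
    ~~ (p %| cur W)%Z /\ ~~ (p %| prv W)%Z.
  move=> k0 nu_eq; case/nandP: pW => pc.
    by split=> //; apply/(nu2 k k0); rewrite -nu_eq; apply/(nu1 k k0).
  by split=> //; apply/(nu1 k k0); rewrite nu_eq; apply/(nu2 k k0).
have one_neq0 : (1 : int) != 0 by [].
split=> [nu_neq [n [n_neq0 nu_eq nu_gt0]]|nu_eq n /dvdzP[k nE]].
  have n_zero : consecutive_zeros_mod p n.
    apply/consecutive_zeros_modP.
    by split; apply: dvdz_of_nu_gt0; rewrite ?nu_eq.
  have zeros_mul k : consecutive_zeros_mod p (N0 * k).
    have [->|k0] := eqVneq k 0; first by rewrite mulr0.
    apply: (consecutive_zeros_mod_first_order
              cur_1 prv_1 curE prvE _ (foW k k0)).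
    by rewrite addn_gt0 e_gt0.
  have zeros_add := consecutive_zeros_mod_add x_root cur_1 prv_1 curE prvE.
  have N0_dvd : (N0 %| n)%Z.
    apply: smallest_positive_dvdz (zeros_add p) zeros_mul n_zero.
    by split.
  have /dvdzP[k nE] := N0_dvd; rewrite mulrC in nE.
  have k0 : k != 0 by apply/eqP => k0; apply: n_neq0; rewrite nE k0 mulr0.
  rewrite nE in nu_eq; have [pc1 pc2] := both_units _ k0 nu_eq.
  apply: nu_neq; have := nu1 1 one_neq0; have := nu2 1 one_neq0; rewrite mulr1.
  by move=> [_ ->] // [_ ->].
have [pc1 pc2] : ~~ (p %| cur W)%Z /\ ~~ (p %| prv W)%Z.
  by apply: (both_units 1) => //; rewrite mulr1.
have nuN0 : nu p (tribonacci N0) = (e%:Z)%:E.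
  by have := (nu1 1 one_neq0).2 pc1; rewrite mulr1 logn1 addn0.
rewrite mulrC in nE; rewrite nuN0 nE mulKz ?lt0r_neq0 //.
(* At n = 0 both sides are infinite, as T_0 = T_(-1) = 0. *)
have [->|k0] := eqVneq k 0.
  by rewrite mulr0 /nu /=.
rewrite (nu1 k k0).2 // (nu2 k k0).2 //; split=> //.
by rewrite /nu (negPf k0) -EFinD addrC PoszD.
Qed.
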